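(* Let $r\in[0,1]$, $\sigma>0$, $L_2>0$, $K_+,K_-\in\mathbb N_0$. There exist a dataset space $\mathbb X$ of finite sets, a pair of datasets $x\simeq_{K_+,K_-}x'$, and a function $h:\mathbb Y\to\mathbb R^D$ with $\max_{y\simeq_\pm y'}\|h(y)-h(y')\|_2=L_2$ such that, for $M=B\circ S$ with $S$ Poisson subsampling at rate $r$ and $B(y)=h(y)+V$, $V\sim\mathcal N(0,\sigma^2I_D)$, $$\Psi_\alpha(m_x\|m_{x'})=\Psi_\alpha\Big(\sum_{i=1}^{K_-+1}f^{(1)}_i\,\mathrm{Binom}(i-1\mid K_-,r)\ \Big\|\ \sum_{j=1}^{K_++1}f^{(2)}_j\,\mathrm{Binom}(j-1\mid K_+,r)\Big),$$ with $f^{(1)}_i$ the univariate normal density with mean $i-1$ and standard deviation $\sigma/L_2$ and $f^{(2)}_j$ the univariate normal density with mean $-(j-1)$ and standard deviation $\sigma/L_2$.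
   Context: Batches are subsets $y\subseteq x$ of datasets; Poisson subsampling with rate $r$: $s_x(y)=r^{|y|}(1-r)^{|x|-|y|}$ for $y\subseteq x$; $m_x(z)=\sum_y b_y(z)s_x(y)$ with $b_y$ the density of $B(y)$. $y\simeq_\pm y'$ iff one is obtained from the other by inserting or removing a single element. $x\simeq_{K_+,K_-}x'$ iff $x'=(x\setminus g_-)\cup g_+$ with $g_-\subseteq x$, $|g_-|=K_-$, $g_+\cap x=\emptyset$, $|g_+|=K_+$. $\mathrm{Binom}(k\mid n,r)=\binom nk r^k(1-r)^{n-k}$. $H_\alpha(p\|q)=\int\max\{p-\alpha q,0\}$ ($\alpha\ge0$), $\Lambda_\alpha(p\|q)=\int p^\alpha q^{1-\alpha}$ ($\alpha>1$); $\Psi_\alpha$ is either. *)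

(* Defs.v *)
From HB Require Import structures.
From mathcomp Require Import all_boot all_order all_algebra.
From mathcomp Require Import all_classical all_reals all_analysis.
Set Implicit Arguments. Unset Strict Implicit. Unset Printing Implicit Defensive.
Import Order.TTheory GRing.Theory Num.Theory.
Local Open Scope ring_scope.

Section defs.
Context {R : realType}.

Definition norm2 (D : nat) (v : 'rV[R]_D) : R := Num.sqrt (\sum_(i < D) v 0 i ^+ 2).

Definition adj_pm (T : finType) (y y' : {set T}) : Prop :=
  exists a : T, (a \notin y /\ y' = a |: y) \/ (a \notin y' /\ y = a |: y').

Definition adj_K (T : finType) (Kp Km : nat) (x x' : {set T}) : Prop :=
  exists (gm gp : {set T}), [/\ gm \subset x, #|gm| = Km, [disjoint gp & x],
    #|gp| = Kp & x' = (x :\: gm) :|: gp].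

Definition binomp (k n : nat) (r : R) : R := 'C(n, k)%:R * r ^+ k * (1 - r) ^+ (n - k).

Definition poisson_s (T : finType) (r : R) (x y : {set T}) : R :=
  r ^+ #|y| * (1 - r) ^+ (#|x| - #|y|).

Definition gauss_pdf (D : nat) (mu : 'rV[R]_D) (s : R) (z : 'rV[R]_D) : R :=
  (Num.sqrt (s ^+ 2 * pi *+ 2))^-1 ^+ D * expR (- (norm2 (z - mu)) ^+ 2 / (s ^+ 2 *+ 2)).

(* density of the subsampled Gaussian mechanism: m_x(z) = sum_{y \subset x} b_y(z) s_x(y) *)
Definition mix_density (T : finType) (D : nat) (h : {set T} -> 'rV[R]_D) (s r : R)
    (x : {set T}) (z : 'rV[R]_D) : R :=
  \sum_(y : {set T} | y \subset x) gauss_pdf (h y) s z * poisson_s r x y.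

(* Lebesgue integral over R^D of a nonnegative function, as an iterated
   integral over the coordinates (equal to the integral w.r.t. D-dimensional
   Lebesgue measure for nonnegative measurable integrands, by Tonelli). *)
Fixpoint intRD (D : nat) : ('rV[R]_D -> \bar R) -> \bar R :=
  match D return ('rV[R]_D -> \bar R) -> \bar R with
  | 0 => fun f => f 0
  | D'.+1 => fun f =>
      (\int[@lebesgue_measure R]_t intRD (fun v : 'rV[R]_D' => f (row_mx (const_mx (t : R) : 'rV[R]_1) v)))%E
  end.

Definition hockeyD (D : nat) (alpha : R) (p q : 'rV[R]_D -> R) : \bar R :=
  intRD (fun z => (Num.max (p z - alpha * q z) 0)%:E).
Definition lambdaD (D : nat) (alpha : R) (p q : 'rV[R]_D -> R) : \bar R :=
  intRD (fun z => (powR (p z) alpha * powR (q z) (1 - alpha))%:E).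

Definition hockey1 (alpha : R) (p q : R -> R) : \bar R :=
  (\int[@lebesgue_measure R]_t (Num.max (p t - alpha * q t) 0)%:E)%E.
Definition lambda1 (alpha : R) (p q : R -> R) : \bar R :=
  (\int[@lebesgue_measure R]_t (powR (p t) alpha * powR (q t) (1 - alpha))%:E)%E.

End defs.

(* Main.v *)
Require Import Defs.
From mathcomp Require Import all_boot all_order all_algebra all_classical all_reals all_analysis.
From mathcomp Require Import ring.
Import Order.TTheory GRing.Theory Num.Theory numFieldNormedType.Exports.
Local Open Scope ring_scope.

(* The witness is a one-dimensional signed counting query: the points of x'
   count -L2, all other points (x and one spare point) count +L2, so adjacent
   batches always differ by exactly L2.  A Poisson subsample of x contains
   Binom(K_-, r) points, all positive, and one of x' contains Binom(K_+, r)
   points, all negative; hence m_x and m_x' are binomial mixtures of Gaussians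
   centred at L2 k and -L2 k.  Both divergences are invariant under the change
   of variables t = z / L2, which turns these into the mixtures f1 and f2. *)

Section rescaling.
Context {R : realType}.
Notation mu := (@lebesgue_measure R).

Lemma integral_rescale_ge0 (c : R) (H : R -> R) :
  0 < c -> continuous H -> (forall t, 0 <= H t) ->
  (\int[mu]_t (c^-1 * H (t / c))%:E = \int[mu]_t (H t)%:E)%E.
Proof.
move=> c_gt0 H_cont H_ge0.
have ci_gt0 : 0 < c^-1 by rewrite invr_gt0.
have scale_derive : (fun t : R => c^-1 * t)^`()%classic = cst c^-1.
  apply/funext => t.
  by rewrite (@derive1Ml _ id) ?derive1_id ?mulr1//; exact: derivable_id.
rewrite [RHS](@increasing_ge0_integration_by_substitutionT _ (fun t => c^-1 * t))
  //; last first.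
- by apply/cvgryPge => A; near=> t; rewrite -ler_pdivrMl//; near: t.
- by apply/cvgrNyPle => A; near=> t; rewrite -ler_pdivlMl//; near: t.
- by rewrite scale_derive; exact: is_cvg_cst.
- by rewrite scale_derive; exact: is_cvg_cst.
- by rewrite scale_derive; exact: cst_continuous.
- by move=> s t st; rewrite ltr_pM2l.
by apply: eq_integral => t _; rewrite scale_derive /= mulrC (mulrC t).
Unshelve. all: end_near. Qed.

Lemma intRD1 (f : 'rV[R]_1 -> \bar R) :
  intRD f = (\int[mu]_t f (const_mx t))%E.
Proof.
apply: eq_integral => t _ /=.
by rewrite -(thinmx0 (const_mx t : 'rV_0)) row_mx_const.
Qed.

Variables (c : R) (f g : R -> R).
Hypotheses (c_gt0 : 0 < c) (f_cont : continuous f) (g_cont : continuous g).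

Let rescale (u : R -> R) (z : 'rV[R]_1) := c^-1 * u (z 0 0 / c).

Lemma hockeyD_rescale alpha :
  hockeyD alpha (rescale f) (rescale g) = hockey1 alpha f g.
Proof.
rewrite /hockeyD intRD1 /hockey1 -[RHS](@integral_rescale_ge0 c); first last.
- by move=> t; rewrite le_max lexx orbT.
- apply: (@max_fun_continuous _ _ _ (fun t => f t - alpha * g t) (cst 0));
    last exact: cst_continuous.
  move=> t; apply: (@continuousB _ _ _ f (fun t => alpha * g t)); first exact: f_cont.
  apply: (@continuousM _ _ (cst alpha) g); [exact: cst_continuous | exact: g_cont].
- exact: c_gt0.
apply: eq_integral => t _; rewrite /rescale mxE; congr (_%:E).
by rewrite maxr_pMr ?invr_ge0 ?ltW // mulr0 mulrBr mulrCA.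
Qed.

Lemma continuous_powR_pos (u : R -> R) a :
  continuous u -> (forall t, 0 < u t) -> continuous (fun t => powR (u t) a).
Proof.
move=> u_cont u_gt0.
have -> : (fun t => powR (u t) a) = (fun t => expR (a * ln (u t))).
  by apply/funext => t; rewrite /powR gt_eqF.
move=> t; apply: (@continuous_comp _ _ _ (fun t => a * ln (u t)) expR);
  last exact: continuous_expR.
apply: (@continuousM _ _ (cst a) (fun t => ln (u t))); first exact: cst_continuous.
exact: continuous_comp (u_cont t) (continuous_ln (u_gt0 t)).
Qed.

Hypotheses (f_gt0 : forall t, 0 < f t) (g_gt0 : forall t, 0 < g t).

Lemma lambdaD_rescale alpha :
  lambdaD alpha (rescale f) (rescale g) = lambda1 alpha f g.
Proof.
rewrite /lambdaD intRD1 /lambda1 -[RHS](@integral_rescale_ge0 c); first last.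
- by move=> t; rewrite mulr_ge0 ?powR_ge0.
- move=> t; apply: (@continuousM _ _ (fun t => powR (f t) alpha)
                                      (fun t => powR (g t) (1 - alpha)));
  exact: continuous_powR_pos.
- exact: c_gt0.
apply: eq_integral => t _; rewrite /rescale mxE; congr (_%:E).
have ci_ge0 : 0 <= c^-1 by rewrite invr_ge0 ltW.
rewrite !powRM ?(ltW (f_gt0 _)) ?(ltW (g_gt0 _)) // mulrACA -powRD; last first.
  by rewrite invr_eq0 (gt_eqF c_gt0) implybT.
by rewrite addrCA subrr addr0 powRr1.
Qed.

End rescaling.

Section densities.
Context {R : realType}.

Lemma norm2_rV1 (v : 'rV[R]_1) : norm2 v = `|v 0 0|.
Proof. by rewrite /norm2 big_ord1 sqrtr_sqr. Qed.

Lemma gauss_pdf1 (sigma c m : R) (z : 'rV[R]_1) : 0 < sigma -> 0 < c ->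
  gauss_pdf (const_mx (c * m)) sigma z = c^-1 * normal_pdf m (sigma / c) (z 0 0 / c).
Proof.
move=> sigma_gt0 c_gt0; have c_neq0 : c != 0 by rewrite gt_eqF.
rewrite /gauss_pdf normal_pdfE ?mulf_neq0 ?invr_eq0 ?gt_eqF //.
rewrite /normal_peak /normal_fun norm2_rV1 real_normK ?num_real // !mxE expr1 mulrA.
congr (_ * _); last by congr expR; field; rewrite c_neq0 gt_eqF.
have var_ge0 : 0 <= sigma ^+ 2 * pi *+ 2 by rewrite mulrn_wge0 // mulr_ge0 ?sqr_ge0 ?pi_ge0.
have -> : (sigma / c) ^+ 2 * pi *+ 2 = (sigma ^+ 2 * pi *+ 2) * c^-1 ^+ 2 by ring.
by rewrite sqrtrM // sqrtr_sqr gtr0_norm ?invr_gt0 // invfM invrK mulrCA mulVf // mulr1.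
Qed.

Lemma binomp_ge0 (r : R) k n : 0 <= r -> r <= 1 -> 0 <= binomp k n r.
Proof. by move=> r_ge0 r_le1; rewrite /binomp !mulr_ge0 ?exprn_ge0 ?subr_ge0. Qed.

Lemma binomp_exists_gt0 n (r : R) : 0 <= r -> r <= 1 ->
  exists i : 'I_n.+1, 0 < binomp i n r.
Proof.
move=> r_ge0 r_le1; have [r_lt1|r_ge1] := ltP r 1.
  by exists ord0; rewrite /binomp bin0 !mul1r subn0 exprn_gt0 // subr_gt0.
have -> : r = 1 by apply/le_anti; rewrite r_le1 r_ge1.
by exists ord_max; rewrite /binomp /= binn subnn expr1n !mul1r expr0.
Qed.

Lemma sum_subset_poisson_s (T : finType) (A : {set T}) (F : nat -> R) (r : R) :
  \sum_(y : {set T} | y \subset A) F #|y| * poisson_s r A y =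
  \sum_(k < #|A|.+1) F k * binomp k #|A| r.
Proof.
rewrite (partition_big (fun y : {set T} => inord #|y| : 'I_#|A|.+1) predT) //=.
apply: eq_bigr => k _.
rewrite (eq_bigl (fun y => y \in [set y : {set T} | y \subset A & #|y| == k]));
  last first.
  move=> y; rewrite inE; case yA: (y \subset A) => //=.
  have y_lt : (#|y| < #|A|.+1)%N by rewrite ltnS subset_leq_card.
  apply/eqP/eqP => [<-|y_k]; first by rewrite inordK.
  by apply: val_inj; rewrite /= inordK // y_k.
rewrite (eq_bigr (fun _ => F k * (r ^+ k * (1 - r) ^+ (#|A| - k)))); last first.
  by move=> y; rewrite inE /poisson_s => /andP[_ /eqP ->].
by rewrite sumr_const cards_draws /binomp -mulrnAr -mulr_natl !mulrA.
Qed.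

Lemma mix_density_card (T : finType) (D : nat) (h : {set T} -> 'rV[R]_D)
    (g : nat -> 'rV[R]_D) (s r : R) (x : {set T}) (z : 'rV[R]_D) :
  (forall y : {set T}, y \subset x -> h y = g #|y|) ->
  mix_density h s r x z = \sum_(k < #|x|.+1) gauss_pdf (g k) s z * binomp k #|x| r.
Proof.
move=> hg; rewrite /mix_density.
rewrite -(sum_subset_poisson_s _ x (fun k => gauss_pdf (g k) s z)).
by apply: eq_bigr => y /hg ->.
Qed.

Lemma continuous_normal_mixture n (m w : 'I_n -> R) (s : R) : s != 0 ->
  continuous (fun t => \sum_(i < n) normal_pdf (m i) s t * w i).
Proof.
move=> s_neq0; apply: continuous_big => [|i _ t]; first exact: add_continuous.
apply: (@continuousM _ _ (normal_pdf (m i) s) (cst (w i))); last exact: cst_continuous.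
exact: continuous_normal_pdf.
Qed.

Lemma normal_binom_mixture_gt0 n (m : 'I_n.+1 -> R) (s r t : R) :
  s != 0 -> 0 <= r -> r <= 1 ->
  0 < \sum_(i < n.+1) normal_pdf (m i) s t * binomp i n r.
Proof.
move=> s_neq0 r_ge0 r_le1; have [i binom_gt0] := binomp_exists_gt0 n r r_ge0 r_le1.
rewrite (bigD1 i) //= ltr_pwDl //.
  by rewrite mulr_gt0 // normal_pdfE // mulr_gt0 ?expR_gt0 ?normal_peak_gt0.
by apply: sumr_ge0 => j _; rewrite mulr_ge0 ?normal_pdf_ge0 ?binomp_ge0.
Qed.

End densities.

Section witness.
Context {R : realType}.
Variables (Km Kp : nat).
Local Notation T := (option ('I_Km + 'I_Kp)).

Definition dataset_x : {set T} := [set Some (inl i) | i : 'I_Km].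
Definition dataset_x' : {set T} := [set Some (inr j) | j : 'I_Kp].

Definition query_sign (t : T) : R := if t \in dataset_x' then -1 else 1.

Definition signed_count_query (c : R) (y : {set T}) : 'rV[R]_1 :=
  const_mx (c * \sum_(t in y) query_sign t).

Lemma card_dataset_x : #|dataset_x| = Km.
Proof. by rewrite card_imset ?card_ord // => i j []. Qed.

Lemma card_dataset_x' : #|dataset_x'| = Kp.
Proof. by rewrite card_imset ?card_ord // => i j []. Qed.

Lemma disjoint_dataset_x'x : [disjoint dataset_x' & dataset_x].
Proof.
rewrite finset.disjoints_subset; apply/fintype.subsetP => t /imsetP[j _ ->]; rewrite inE.
by apply/negP => /imsetP[i _ []].
Qed.

Lemma adj_K_dataset : adj_K Kp Km dataset_x dataset_x'.
Proof.
exists dataset_x, dataset_x'; split => //.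
- by rewrite card_dataset_x.
- exact: disjoint_dataset_x'x.
- by rewrite card_dataset_x'.
- by rewrite finset.setDv finset.set0U.
Qed.

Lemma norm2_signed_count_query_adj (c : R) (y y' : {set T}) :
  adj_pm y y' -> norm2 (signed_count_query c y - signed_count_query c y') = `|c|.
Proof.
have step (u : {set T}) a : a \notin u ->
    `|c * \sum_(t in a |: u) query_sign t - c * \sum_(t in u) query_sign t| = `|c|.
  move=> a_u; rewrite big_setU1 //= mulrDr addrK normrM.
  by rewrite /query_sign; case: ifP => _; rewrite ?normrN normr1 mulr1.
rewrite norm2_rV1 !mxE => -[a [[a_y ->] | [a_y' ->]]]; last exact: step.
by rewrite distrC step.
Qed.

Lemma signed_count_query_sub_x (c : R) (y : {set T}) : y \subset dataset_x ->
  signed_count_query c y = const_mx (c * #|y|%:R).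
Proof.
move=> y_x; rewrite /signed_count_query.
under eq_bigr => t t_y.
  rewrite /query_sign (disjointFl disjoint_dataset_x'x (fintype.subsetP y_x t t_y)).
over.
by rewrite sumr_const.
Qed.

Lemma signed_count_query_sub_x' (c : R) (y : {set T}) : y \subset dataset_x' ->
  signed_count_query c y = const_mx (c * - #|y|%:R).
Proof.
move=> y_x'; rewrite /signed_count_query.
under eq_bigr => t t_y do rewrite /query_sign (fintype.subsetP y_x' t t_y).
by rewrite sumr_const mulNrn.
Qed.

Variables (sigma c r : R).
Hypotheses (sigma_gt0 : 0 < sigma) (c_gt0 : 0 < c).

Lemma mix_density_dataset_x (z : 'rV[R]_1) :
  mix_density (signed_count_query c) sigma r dataset_x z =
  c^-1 * \sum_(i < Km.+1) normal_pdf i%:R (sigma / c) (z 0 0 / c) * binomp i Km r.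
Proof.
rewrite (mix_density_card _ _ _ (fun k => const_mx (c * k%:R)));
  last exact: signed_count_query_sub_x.
rewrite card_dataset_x mulr_sumr; apply: eq_bigr => i _.
by rewrite gauss_pdf1 // -mulrA.
Qed.

Lemma mix_density_dataset_x' (z : 'rV[R]_1) :
  mix_density (signed_count_query c) sigma r dataset_x' z =
  c^-1 * \sum_(j < Kp.+1) normal_pdf (- j%:R) (sigma / c) (z 0 0 / c) * binomp j Kp r.
Proof.
rewrite (mix_density_card _ _ _ (fun k => const_mx (c * - k%:R)));
  last exact: signed_count_query_sub_x'.
rewrite card_dataset_x' mulr_sumr; apply: eq_bigr => j _.
by rewrite gauss_pdf1 // -mulrA.
Qed.

End witness.

Theorem mainTheorem9 (R : realType) (r sigma L2 : R) (Kp Km : nat)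
  (hr0 : 0 <= r) (hr1 : r <= 1) (hsigma : 0 < sigma) (hL2 : 0 < L2) :
  exists (T : finType) (x x' : {set T}) (D : nat) (h : {set T} -> 'rV[R]_D),
    [/\ adj_K Kp Km x x',
        (forall y y' : {set T}, adj_pm y y' -> norm2 (h y - h y') <= L2),
        (exists y y' : {set T}, adj_pm y y' /\ norm2 (h y - h y') = L2) &
        let mx := mix_density h sigma r x in
        let mx' := mix_density h sigma r x' in
        let f1 := fun t : R => \sum_(i < Km.+1)
                    normal_pdf (i%:R) (sigma / L2) t * binomp i Km r in
        let f2 := fun t : R => \sum_(j < Kp.+1)
                    normal_pdf (- j%:R) (sigma / L2) t * binomp j Kp r in
        (forall alpha : R, 0 <= alpha -> hockeyD alpha mx mx' = hockey1 alpha f1 f2) /\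
        (forall alpha : R, 1 < alpha -> lambdaD alpha mx mx' = lambda1 alpha f1 f2)].
Proof.
pose h := signed_count_query Km Kp L2.
have sensitivity y y' : adj_pm y y' -> norm2 (h y - h y') = L2.
  by move/norm2_signed_count_query_adj ->; rewrite gtr0_norm.
exists (option ('I_Km + 'I_Kp)), (dataset_x Km Kp), (dataset_x' Km Kp), 1%N, h.
split.
- exact: adj_K_dataset.
- by move=> y y' /sensitivity ->.
- have adj_None : adj_pm finset.set0 [set None : option ('I_Km + 'I_Kp)].
    by exists None; left; rewrite finset.in_set0 finset.setU0.
  by exists finset.set0, [set None]; split; last exact: sensitivity.
move=> mx mx' f1 f2.
have -> : mx = fun z => L2^-1 * f1 (z 0 0 / L2).
  by apply/funext => z; exact: mix_density_dataset_x.
have -> : mx' = fun z => L2^-1 * f2 (z 0 0 / L2).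
  by apply/funext => z; exact: mix_density_dataset_x'.
have scale_neq0 : sigma / L2 != 0 by rewrite mulf_neq0 ?invr_eq0 ?gt_eqF.
have f1_cont : continuous f1 by exact: continuous_normal_mixture.
have f2_cont : continuous f2 by exact: continuous_normal_mixture.
have f1_gt0 t : 0 < f1 t by exact: normal_binom_mixture_gt0.
have f2_gt0 t : 0 < f2 t by exact: normal_binom_mixture_gt0.
by split => alpha _; [exact: hockeyD_rescale | exact: lambdaD_rescale].
Qed.
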